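(* Let $\mathfrak{R}$ be an expansion of the real field $(\mathbb{R},+,\cdot)$ (i.e., a first-order structure on $\mathbb{R}$ whose language includes $+$ and $\cdot$). Then either $\mathbb{Z}$ is definable in $\mathfrak{R}$, or every bounded nowhere dense subset of $\mathbb{R}$ that is definable in $\mathfrak{R}$ is M-null.
   Context: ''Definable'' means definable with parameters in the structure $\mathfrak{R}$. For a bounded set $E\subseteq\mathbb{R}^n$ and $r>0$, let $N(E,r)$ be the number of closed balls of radius $r$ needed to cover $E$. The upper Minkowski dimension of $E$ is $\overline{\dim}_M E=\limsup_{r\downarrow 0}\log N(E,r)/\log(1/r)$, with the convention $\log 0:=-\infty$. A bounded set $E$ is called M-null if $\overline{\dim}_M E\le 0$. *)

(* Defs.v *)
From Stdlib Require Import Reals Rtopology.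
From Stdlib Require Vectors.Fin.
Open Scope R_scope.

(** A first-order structure on R expanding (R,+,.): a language with extra
    function symbols and relation symbols (each with an arity), together
    with their interpretations on R.  The symbols + and . are built into
    the term syntax and always interpreted as Rplus and Rmult. *)
Record expansion := {
  fsym : Type;
  rsym : Type;
  farity : fsym -> nat;
  rarity : rsym -> nat;
  finterp : forall f : fsym, (Fin.t (farity f) -> R) -> R;
  rinterp : forall r : rsym, (Fin.t (rarity r) -> R) -> Prop
}.

Section Syntax.
Variable M : expansion.

Inductive term : Type :=
| tvar : nat -> term
| tplus : term -> term -> term
| tmult : term -> term -> term
| tapp : forall f : fsym M, (Fin.t (farity M f) -> term) -> term.

Inductive formula : Type :=
| fEq : term -> term -> formula
| fRel : forall r : rsym M, (Fin.t (rarity M r) -> term) -> formula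
| fNot : formula -> formula
| fAnd : formula -> formula -> formula
| fOr : formula -> formula -> formula
| fImp : formula -> formula -> formula
| fEx : nat -> formula -> formula
| fAll : nat -> formula -> formula.

Definition upd (v : nat -> R) (i : nat) (x : R) : nat -> R :=
  fun j => if Nat.eqb j i then x else v j.

Fixpoint teval (v : nat -> R) (t : term) : R :=
  match t with
  | tvar i => v i
  | tplus t1 t2 => teval v t1 + teval v t2
  | tmult t1 t2 => teval v t1 * teval v t2
  | tapp f args => finterp M f (fun k => teval v (args k))
  end.

Fixpoint sat (v : nat -> R) (phi : formula) : Prop :=
  match phi with
  | fEq t1 t2 => teval v t1 = teval v t2
  | fRel r args => rinterp M r (fun k => teval v (args k))
  | fNot p => ~ sat v p
  | fAnd p q => sat v p /\ sat v q
  | fOr p q => sat v p \/ sat v q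
  | fImp p q => sat v p -> sat v q
  | fEx i p => exists x : R, sat (upd v i x) p
  | fAll i p => forall x : R, sat (upd v i x) p
  end.

(** A set X of reals is definable (with parameters) in M: there is a formula
    phi and an assignment v (giving values to the parameter variables) such
    that X = { x | M |= phi(x, v) } where x is the value of variable 0. *)
Definition definable (X : R -> Prop) : Prop :=
  exists (phi : formula) (v : nat -> R),
    forall x : R, X x <-> sat (upd v 0 x) phi.

End Syntax.

Arguments definable : clear implicits.

Definition Zset (x : R) : Prop := exists z : Z, x = IZR z.

Definition nowhere_dense (E : R -> Prop) : Prop :=
  forall x : R, ~ interior (adherence E) x.

Definition coverable (E : R -> Prop) (r : R) (n : nat) : Prop :=
  exists c : nat -> R, forall x, E x -> exists i, (i < n)%nat /\ Rabs (x - c i) <= r.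

Definition cover_number (E : R -> Prop) (r : R) (n : nat) : Prop :=
  coverable E r n /\ forall m, (m < n)%nat -> ~ coverable E r m.

(** upper Minkowski dimension <= 0, i.e.
    limsup_{r -> 0+} log N(E,r) / log(1/r) <= 0, with log 0 = -oo.
    Unfolded: for every eps > 0, for all sufficiently small r > 0,
    either N(E,r) = 0 (quotient = -oo) or log N(E,r)/log(1/r) <= eps. *)
Definition M_null (E : R -> Prop) : Prop :=
  bounded E /\
  forall eps : R, 0 < eps ->
    exists delta : R, 0 < delta /\
      forall r : R, 0 < r < delta ->
        forall n : nat, cover_number E r n ->
          n = 0%nat \/ ln (INR n) / ln (1 / r) <= eps.

(* Main.v *)
Require Import Defs.
From Stdlib Require Import Reals Rtopology ZArith Lra Lia List Classical.
From Stdlib Require Import ClassicalEpsilon FunctionalExtensionality.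
Import ListNotations.
Open Scope R_scope.

(** Let [E] be definable, bounded and nowhere dense.  The left ends [D] of the
    gaps of the closure of [E] are dense in that closure, and [D] is an
    increasing union of finite sets [D e] (gaps of length at least [e]), uniformly
    definable in [e].

    Given such a family [F], either the quotients [(a - b) / (c - d)] are dense
    in [(0, 1/2)], or some [t] stays away from them.  In the second case
    [(x, y) |-> x - t y] is injective on [F * F] with a lower Lipschitz bound, so
    [F - t F] has the squared packing numbers of [F].  If [E] is not M-null, this
    cannot happen indefinitely, since a bounded set of reals has packing numbers
    [O(1/r)].  Hence some definable growing family of finite sets has a union [A]
    dense in [(0, 1/2)].

    Such a family defines the integers.  For [a] in [A] let [m(a)] be the distance
    from [a] to the other points present when [a] enters.  Nested intervals
    produce a real [c] such that the points [a] with [0 < c - a < m(a)^3] form,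
    up to finitely many, a sequence [a_k] with [m(a_k)^4 / (c - a_k)] in
    [[k, k + 1/k]].  Then [x] is an integer iff translation by [x] maps these
    codes asymptotically to codes. *)

(** * Definable predicates with parameters *)

Section Definability.
Variable M : expansion.

Fixpoint rename_term (s : nat -> nat) (t : term M) : term M :=
  match t with
  | tvar _ i => tvar M (s i)
  | tplus _ t1 t2 => tplus M (rename_term s t1) (rename_term s t2)
  | tmult _ t1 t2 => tmult M (rename_term s t1) (rename_term s t2)
  | tapp _ f args => tapp M f (fun k => rename_term s (args k))
  end.

Fixpoint rename (s : nat -> nat) (phi : formula M) : formula M :=
  match phi with
  | fEq _ t1 t2 => fEq M (rename_term s t1) (rename_term s t2)
  | fRel _ r args => fRel M r (fun k => rename_term s (args k))
  | fNot _ p => fNot M (rename s p)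
  | fAnd _ p q => fAnd M (rename s p) (rename s q)
  | fOr _ p q => fOr M (rename s p) (rename s q)
  | fImp _ p q => fImp M (rename s p) (rename s q)
  | fEx _ i p => fEx M (s i) (rename s p)
  | fAll _ i p => fAll M (s i) (rename s p)
  end.

Lemma teval_rename s t v :
  teval M v (rename_term s t) = teval M (fun i => v (s i)) t.
Proof.
  induction t as [i|t1 IH1 t2 IH2|t1 IH1 t2 IH2|f args IH]; simpl.
  - reflexivity.
  - now rewrite IH1, IH2.
  - now rewrite IH1, IH2.
  - f_equal. apply functional_extensionality. exact IH.
Qed.

Lemma upd_rename s v i x :
  (forall i j, s i = s j -> i = j) ->
  (fun j => upd v (s i) x (s j)) = upd (fun j => v (s j)) i x.
Proof.
  intro Hs. apply functional_extensionality. intro j. unfold upd.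
  destruct (Nat.eqb_spec (s j) (s i)) as [H|H];
    destruct (Nat.eqb_spec j i) as [H'|H']; auto.
  - elim H'. now apply Hs.
  - subst. now elim H.
Qed.

(** Bound variables are renamed along with the free ones; injectivity of [s] is what rules out
    capture. *)
Lemma sat_rename s phi :
  (forall i j, s i = s j -> i = j) ->
  forall v, sat M v (rename s phi) <-> sat M (fun i => v (s i)) phi.
Proof.
  intro Hs.
  induction phi as [t1 t2|r args|p IH|p IHp q IHq|p IHp q IHq|p IHp q IHq|i p IH|i p IH];
    intro v; simpl.
  - rewrite !teval_rename. tauto.
  - replace (fun k => teval M v (rename_term s (args k)))
      with (fun k => teval M (fun i => v (s i)) (args k)); [tauto|].
    apply functional_extensionality. intro k. now rewrite teval_rename.
  - rewrite IH. tauto.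
  - rewrite IHp, IHq. tauto.
  - rewrite IHp, IHq. tauto.
  - rewrite IHp, IHq. tauto.
  - split; intros [x Hx]; exists x; apply IH in Hx || apply IH;
      rewrite upd_rename in *; assumption.
  - split; intros H x; specialize (H x); apply IH in H || apply IH;
      rewrite upd_rename in *; assumption.
Qed.

(* Even positions carry the variables, odd positions the parameters. *)
Definition glue (v w : nat -> R) : nat -> R :=
  fun i => if Nat.even i then v (Nat.div2 i) else w (Nat.div2 i).

Lemma glue_even v w i : glue v w (2 * i) = v i.
Proof.
  unfold glue. rewrite Nat.even_even, Nat.div2_even. reflexivity.
Qed.

Lemma glue_odd v w i : glue v w (2 * i + 1) = w i.
Proof.
  unfold glue. rewrite Nat.even_odd, Nat.div2_odd'. reflexivity.
Qed.

Lemma even_odd_ind (P : nat -> Prop) :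
  (forall i, P (2 * i)%nat) -> (forall i, P (2 * i + 1)%nat) -> forall n, P n.
Proof.
  intros H0 H1 n. destruct (Nat.Even_or_Odd n) as [[k ->]|[k ->]]; auto.
Qed.

Definition interleave (s t : nat -> nat) : nat -> nat :=
  fun i => if Nat.even i then s (Nat.div2 i) else t (Nat.div2 i).

Lemma interleave_even s t i : interleave s t (2 * i) = s i.
Proof.
  unfold interleave. rewrite Nat.even_even, Nat.div2_even. reflexivity.
Qed.

Lemma interleave_odd s t i : interleave s t (2 * i + 1) = t i.
Proof.
  unfold interleave. rewrite Nat.even_odd, Nat.div2_odd'. reflexivity.
Qed.

(** Predicates live on whole assignments, so arities need no bookkeeping; variables act as de Bruijn
    indices, 0 being the innermost quantified one. *)
Definition definable_pred (P : (nat -> R) -> Prop) : Prop :=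
  exists phi w, forall v, P v <-> sat M (glue v w) phi.

(** Only terms count, and division need not be one: quotients are multiplied out in the formulas
    below. *)
Definition definable_fun (f : (nat -> R) -> R) : Prop :=
  exists t w, forall v, f v = teval M (glue v w) t.

Definition sub_vars (s t : nat -> nat) : nat -> nat :=
  interleave (fun i => 2 * s i)%nat (fun i => 2 * t i + 1)%nat.

Lemma sub_vars_inj s t :
  (forall i j, s i = s j -> i = j) -> (forall i j, t i = t j -> i = j) ->
  forall i j, sub_vars s t i = sub_vars s t j -> i = j.
Proof.
  intros Hs Ht i j. unfold sub_vars.
  revert j. induction i as [i|i] using even_odd_ind; intro j;
  induction j as [j|j] using even_odd_ind;
  rewrite ?interleave_even, ?interleave_odd; intro H.
  - assert (s i = s j) as H' by lia. apply Hs in H'. lia.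
  - lia.
  - lia.
  - assert (t i = t j) as H' by lia. apply Ht in H'. lia.
Qed.

Lemma glue_sub_vars s t v w :
  (fun i => glue v w (sub_vars s t i)) =
  glue (fun i => v (s i)) (fun i => w (t i)).
Proof.
  apply functional_extensionality. intro i. unfold sub_vars.
  induction i as [i|i] using even_odd_ind.
  - now rewrite interleave_even, !glue_even.
  - now rewrite interleave_odd, !glue_odd.
Qed.

Lemma sat_sub_vars s t phi v w :
  (forall i j, s i = s j -> i = j) -> (forall i j, t i = t j -> i = j) ->
  sat M (glue v w) (rename (sub_vars s t) phi) <->
  sat M (glue (fun i => v (s i)) (fun i => w (t i))) phi.
Proof.
  intros Hs Ht. rewrite sat_rename by now apply sub_vars_inj.
  now rewrite glue_sub_vars.
Qed.

Lemma teval_sub_vars s t u v w :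
  teval M (glue v w) (rename_term (sub_vars s t) u) =
  teval M (glue (fun i => v (s i)) (fun i => w (t i))) u.
Proof.
  rewrite teval_rename. now rewrite glue_sub_vars.
Qed.

Lemma glue_params_even (w1 w2 : nat -> R) :
  (fun i => glue w1 w2 (2 * i)%nat) = w1.
Proof. apply functional_extensionality. intro. apply glue_even. Qed.

Lemma glue_params_odd (w1 w2 : nat -> R) :
  (fun i => glue w1 w2 (2 * i + 1)%nat) = w2.
Proof. apply functional_extensionality. intro. apply glue_odd. Qed.

(** Two formulas bring separate parameter sequences; these are interleaved into one, and the
    variables stay in place. *)
Lemma share_params P Q :
  definable_pred P -> definable_pred Q ->
  exists phi psi w, (forall v, P v <-> sat M (glue v w) phi) /\
                    (forall v, Q v <-> sat M (glue v w) psi).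
Proof.
  intros (phi & w1 & H1) (psi & w2 & H2).
  exists (rename (sub_vars (fun i => i) (fun i => 2 * i)%nat) phi),
    (rename (sub_vars (fun i => i) (fun i => 2 * i + 1)%nat) psi), (glue w1 w2).
  split; intro v; rewrite sat_sub_vars by (intros; lia).
  - rewrite glue_params_even. apply H1.
  - rewrite glue_params_odd. apply H2.
Qed.

Lemma share_params_fun f g :
  definable_fun f -> definable_fun g ->
  exists t u w, (forall v, f v = teval M (glue v w) t) /\
                (forall v, g v = teval M (glue v w) u).
Proof.
  intros (t & w1 & H1) (u & w2 & H2).
  exists (rename_term (sub_vars (fun i => i) (fun i => 2 * i)%nat) t),
    (rename_term (sub_vars (fun i => i) (fun i => 2 * i + 1)%nat) u), (glue w1 w2).
  split; intro v; rewrite teval_sub_vars.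
  - rewrite glue_params_even. apply H1.
  - rewrite glue_params_odd. apply H2.
Qed.

Lemma definable_pred_ext P Q :
  (forall v, P v <-> Q v) -> definable_pred P -> definable_pred Q.
Proof.
  intros HPQ (phi & w & H). exists phi, w. intro v. rewrite <- HPQ. apply H.
Qed.

Lemma definable_not P : definable_pred P -> definable_pred (fun v => ~ P v).
Proof.
  intros (phi & w & H). exists (fNot M phi), w. intro v. simpl. now rewrite H.
Qed.

Lemma definable_and P Q :
  definable_pred P -> definable_pred Q -> definable_pred (fun v => P v /\ Q v).
Proof.
  intros HP HQ. destruct (share_params P Q HP HQ) as (phi & psi & w & H1 & H2).
  exists (fAnd M phi psi), w. intro v. simpl. now rewrite H1, H2.
Qed.

Lemma definable_or P Q :
  definable_pred P -> definable_pred Q -> definable_pred (fun v => P v \/ Q v).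
Proof.
  intros HP HQ. destruct (share_params P Q HP HQ) as (phi & psi & w & H1 & H2).
  exists (fOr M phi psi), w. intro v. simpl. now rewrite H1, H2.
Qed.

Lemma definable_imp P Q :
  definable_pred P -> definable_pred Q -> definable_pred (fun v => P v -> Q v).
Proof.
  intros HP HQ. destruct (share_params P Q HP HQ) as (phi & psi & w & H1 & H2).
  exists (fImp M phi psi), w. intro v. simpl. now rewrite H1, H2.
Qed.

(* The bound variable 0 of the body is moved to the first parameter slot, the
   other variables shift down and the parameters shift up. *)
Definition bind_vars (i : nat) : nat :=
  if Nat.even i then
    match Nat.div2 i with O => 1 | S k => 2 * k end
  else 2 * S (Nat.div2 i) + 1.

Lemma bind_vars_var0 : bind_vars 0 = 1%nat.
Proof. reflexivity. Qed.

Lemma bind_vars_even i : bind_vars (2 * S i) = (2 * i)%nat.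
Proof. unfold bind_vars. now rewrite Nat.even_even, Nat.div2_even. Qed.

Lemma bind_vars_odd i : bind_vars (2 * i + 1) = (2 * S i + 1)%nat.
Proof. unfold bind_vars. now rewrite Nat.even_odd, Nat.div2_odd'. Qed.

Lemma bind_vars_inj i j : bind_vars i = bind_vars j -> i = j.
Proof.
  revert j. induction i as [[|i]|i] using even_odd_ind; intro j;
  induction j as [[|j]|j] using even_odd_ind;
  rewrite ?bind_vars_even, ?bind_vars_odd; rewrite ?Nat.mul_0_r, ?bind_vars_var0; lia.
Qed.

(** Frees parameter slot 0 for the bound variable; the value left there is a dummy that the
    quantifier overwrites. *)
Definition pad (w : nat -> R) (i : nat) : R := w (Nat.pred i).

Lemma glue_bind_vars v w x :
  (fun i => upd (glue v (pad w)) 1 x (bind_vars i)) =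
  glue (fun i => match i with O => x | S k => v k end) w.
Proof.
  apply functional_extensionality. intro i.
  induction i as [[|i]|i] using even_odd_ind.
  - reflexivity.
  - rewrite bind_vars_even, glue_even. unfold upd.
    destruct (Nat.eqb_spec (2 * i) 1); [lia|]. apply glue_even.
  - rewrite bind_vars_odd, glue_odd. unfold upd.
    destruct (Nat.eqb_spec (2 * S i + 1) 1); [lia|]. now rewrite glue_odd.
Qed.

Lemma definable_ex (P : R -> (nat -> R) -> Prop) :
  definable_pred (fun v => P (v O) (fun i => v (S i))) ->
  definable_pred (fun v => exists x, P x v).
Proof.
  intros (phi & w & H). exists (fEx M 1 (rename bind_vars phi)), (pad w).
  intro v. simpl.
  split; intros [x Hx]; exists x;
    pose proof (H (fun i => match i with O => x | S k => v k end)) as H';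
    cbv beta iota in H'; change (fun i => v i) with v in H'.
  - apply sat_rename; [exact bind_vars_inj|]. rewrite glue_bind_vars. now apply H'.
  - apply H'. rewrite sat_rename, glue_bind_vars in Hx by exact bind_vars_inj. exact Hx.
Qed.

Lemma definable_all (P : R -> (nat -> R) -> Prop) :
  definable_pred (fun v => P (v O) (fun i => v (S i))) ->
  definable_pred (fun v => forall x, P x v).
Proof.
  intro H.
  apply definable_pred_ext with (P := fun v => ~ exists x, ~ P x v).
  - intro v. split.
    + intros Hn x. apply NNPP. intro Hx. apply Hn. now exists x.
    + intros Ha [x Hx]. now apply Hx.
  - apply definable_not, (definable_ex (fun x v => ~ P x v)), definable_not, H.
Qed.

Lemma definable_fun_var i : definable_fun (fun v => v i).
Proof.
  exists (tvar M (2 * i)), (fun _ => 0). intro v. cbn [teval].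
  now rewrite glue_even.
Qed.

Lemma definable_fun_const c : definable_fun (fun _ => c).
Proof. exists (tvar M 1), (fun _ => c). reflexivity. Qed.

Lemma definable_fun_plus f g :
  definable_fun f -> definable_fun g -> definable_fun (fun v => f v + g v).
Proof.
  intros Hf Hg. destruct (share_params_fun f g Hf Hg) as (t & u & w & H1 & H2).
  exists (tplus M t u), w. intro v. simpl. now rewrite H1, H2.
Qed.

Lemma definable_fun_mult f g :
  definable_fun f -> definable_fun g -> definable_fun (fun v => f v * g v).
Proof.
  intros Hf Hg. destruct (share_params_fun f g Hf Hg) as (t & u & w & H1 & H2).
  exists (tmult M t u), w. intro v. simpl. now rewrite H1, H2.
Qed.

Lemma definable_fun_opp f : definable_fun f -> definable_fun (fun v => - f v).
Proof.
  intro Hf.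
  destruct (definable_fun_mult _ f (definable_fun_const (-1)) Hf) as (t & w & H).
  exists t, w. intro v. rewrite <- H. ring.
Qed.

Lemma definable_fun_minus f g :
  definable_fun f -> definable_fun g -> definable_fun (fun v => f v - g v).
Proof.
  intros Hf Hg. apply definable_fun_plus; [|apply definable_fun_opp]; assumption.
Qed.

Lemma definable_fun_pow f n : definable_fun f -> definable_fun (fun v => f v ^ n).
Proof.
  intro Hf. induction n as [|n IH]; simpl.
  - apply definable_fun_const.
  - apply definable_fun_mult; assumption.
Qed.

(** Weakening: under [k] further quantifiers the old variables move up by [k]. *)
Lemma definable_fun_shift f k :
  definable_fun f -> definable_fun (fun v => f (fun i => v (k + i)%nat)).
Proof.
  intros (t & w & H).
  exists (rename_term (sub_vars (fun i => k + i)%nat (fun i => i)) t), w.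
  intro v. rewrite teval_sub_vars. apply H.
Qed.

Lemma definable_eq f g :
  definable_fun f -> definable_fun g -> definable_pred (fun v => f v = g v).
Proof.
  intros Hf Hg. destruct (share_params_fun f g Hf Hg) as (t & u & w & H1 & H2).
  exists (fEq M t u), w. intro v. simpl. now rewrite H1, H2.
Qed.

(** The order comes from the field structure: a real is nonnegative iff it is a square. *)
Lemma definable_le f g :
  definable_fun f -> definable_fun g -> definable_pred (fun v => f v <= g v).
Proof.
  intros Hf Hg.
  apply definable_pred_ext with (P := fun v => exists z, g v = f v + z * z).
  - intro v. split.
    + intros [z Hz]. nra.
    + intro H. exists (sqrt (g v - f v)). rewrite sqrt_sqrt; lra.
  - apply (definable_ex (fun z v => g v = f v + z * z)). apply definable_eq.
    + exact (definable_fun_shift g 1 Hg).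
    + apply definable_fun_plus; [exact (definable_fun_shift f 1 Hf)|].
      apply definable_fun_mult; apply definable_fun_var.
Qed.

Lemma definable_lt f g :
  definable_fun f -> definable_fun g -> definable_pred (fun v => f v < g v).
Proof.
  intros Hf Hg. apply definable_pred_ext with (P := fun v => ~ g v <= f v).
  - intro v. split; lra.
  - now apply definable_not, definable_le.
Qed.

(** Quantifying over [f] builds closure under substitution of terms into the notion, so it applies
    under any quantifiers. *)
Definition definable1 (X : R -> Prop) : Prop :=
  forall f, definable_fun f -> definable_pred (fun v => X (f v)).

Definition definable2 (X : R -> R -> Prop) : Prop :=
  forall f g, definable_fun f -> definable_fun g ->
  definable_pred (fun v => X (f v) (g v)).

Lemma definable_definable1 X : definable M X -> definable1 X.
Proof.
  intros (phi & w & H) f Hf.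
  (* Naming the value [f v] replaces the substitution of a term by that of a variable. *)
  apply definable_pred_ext with (P := fun v => exists x, x = f v /\ X x).
  - intro v. split; [intros (x & -> & Hx); exact Hx|intro Hx; now exists (f v)].
  - apply (definable_ex (fun x v => x = f v /\ X x)). apply definable_and.
    + apply definable_eq; [apply definable_fun_var|exact (definable_fun_shift f 1 Hf)].
    (* Variable 0 keeps its place; the others, which serve as parameters in [definable], go to the
       odd positions. *)
    + exists (rename (fun i => match i with O => O | S k => 2 * k + 1 end)%nat phi),
        (fun i => w (S i)).
      intro v. rewrite sat_rename by (intros [|i] [|j]; lia).
      rewrite H.
      replace (upd w 0 (v 0%nat)) with
        (fun i => glue v (fun i => w (S i))
           match i with O => O | S k => (2 * k + 1)%nat end); [tauto|].
      apply functional_extensionality. intros [|i]; [reflexivity|].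
      now rewrite glue_odd.
Qed.

Lemma definable1_definable X : definable1 X -> definable M X.
Proof.
  intro H. destruct (H _ (definable_fun_var 0)) as (phi & w & Hphi).
  exists phi, (glue (fun _ => 0) w). intro x.
  rewrite (Hphi (upd (fun _ => 0) 0 x)).
  replace (glue (upd (fun _ => 0) 0 x) w) with (upd (glue (fun _ => 0) w) 0 x);
    [reflexivity|].
  apply functional_extensionality. intro i.
  induction i as [[|i]|i] using even_odd_ind.
  - reflexivity.
  - rewrite glue_even. unfold upd.
    destruct (Nat.eqb_spec (2 * S i) 0); [lia|]. now rewrite glue_even.
  - rewrite glue_odd. unfold upd.
    destruct (Nat.eqb_spec (2 * i + 1) 0); [lia|]. now rewrite glue_odd.
Qed.

End Definability.

(** * Automation for definability *)

Ltac definable_fun_tac :=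
  cbv beta;
  lazymatch goal with
  | |- definable_fun _ (fun v => v _) => apply definable_fun_var
  | |- definable_fun _ (fun v => _ + _) => apply definable_fun_plus; definable_fun_tac
  | |- definable_fun _ (fun v => _ - _) => apply definable_fun_minus; definable_fun_tac
  | |- definable_fun _ (fun v => _ * _) => apply definable_fun_mult; definable_fun_tac
  | |- definable_fun _ (fun v => _ ^ _) => apply definable_fun_pow; definable_fun_tac
  | |- definable_fun _ (fun v => - _) => apply definable_fun_opp; definable_fun_tac
  | |- _ =>
    first [ apply definable_fun_const |
    match goal with
    | H : definable_fun _ ?f |- _ =>
      first [ exact (definable_fun_shift _ f 0 H) | exact (definable_fun_shift _ f 1 H)
            | exact (definable_fun_shift _ f 2 H) | exact (definable_fun_shift _ f 3 H)
            | exact (definable_fun_shift _ f 4 H) | exact (definable_fun_shift _ f 5 H)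
            | exact (definable_fun_shift _ f 6 H) ]
    end ]
  end.

Ltac definable_tac :=
  cbv beta;
  lazymatch goal with
  | |- definable1 _ _ => intros ? ?; definable_tac
  | |- definable2 _ _ => intros ? ? ? ?; definable_tac
  | |- definable_pred _ (fun v => exists x, _) => apply definable_ex; definable_tac
  | |- definable_pred _ (fun v => _ /\ _) => apply definable_and; definable_tac
  | |- definable_pred _ (fun v => _ \/ _) => apply definable_or; definable_tac
  | |- definable_pred _ (fun v => ~ _) => apply definable_not; definable_tac
  | |- definable_pred _ (fun v => _ = _) => apply definable_eq; definable_fun_tac
  | |- definable_pred _ (fun v => _ < _) => apply definable_lt; definable_fun_tac
  | |- definable_pred _ (fun v => _ <= _) => apply definable_le; definable_fun_tac
  | |- definable_pred _ _ =>
    first [ match goal with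
            | H : definable1 _ _ |- _ => apply H; definable_fun_tac
            | H : definable2 _ _ |- _ => apply H; definable_fun_tac
            end
          | apply definable_imp; definable_tac
          | apply definable_all; definable_tac ]
  end.

(** * Coding the integers by a dense family *)

Lemma dependent_choice (T : Type) (G : T -> Prop) (step : nat -> T -> T -> Prop) (x0 : T) :
  G x0 -> (forall n x, G x -> exists y, G y /\ step n x y) ->
  exists s : nat -> T, forall n, G (s n) /\ step n (s n) (s (S n)).
Proof.
  intros H0 Hstep.
  pose (next := fun n (x : {x | G x}) =>
    constructive_indefinite_description _ (Hstep n (proj1_sig x) (proj2_sig x))).
  pose (s := fix s n : {x | G x} :=
    match n with
    | O => exist _ x0 H0
    | S k => exist _ (proj1_sig (next k (s k))) (proj1 (proj2_sig (next k (s k))))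
    end).
  exists (fun n => proj1_sig (s n)). intro n. split.
  - apply proj2_sig.
  - simpl. exact (proj2 (proj2_sig (next n (s n)))).
Qed.

(** The supremum of the left ends works; strict monotonicity of both sequences keeps it inside the
    open intervals. *)
Lemma nested_intervals_point (p q : nat -> R) :
  (forall n, p n < p (S n)) -> (forall n, q (S n) < q n) -> (forall n, p n < q n) ->
  exists c, forall n, p n < c < q n.
Proof.
  intros Hp Hq Hpq.
  assert (Hp' : forall n k, p n <= p (n + k)%nat).
  { intros n k. induction k as [|k IH].
    - rewrite Nat.add_0_r. lra.
    - rewrite Nat.add_succ_r. specialize (Hp (n + k)%nat). lra. }
  assert (Hq' : forall n k, q (n + k)%nat <= q n).
  { intros n k. induction k as [|k IH].
    - rewrite Nat.add_0_r. lra.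
    - rewrite Nat.add_succ_r. specialize (Hq (n + k)%nat). lra. }
  assert (Hub : forall n i, p i <= q n).
  { intros n i. pose proof (Hp' i n). pose proof (Hq' n i).
    rewrite (Nat.add_comm n i) in H0. specialize (Hpq (i + n)%nat). lra. }
  destruct (completeness (fun x => exists i, x = p i)) as [c [Hc1 Hc2]].
  - exists (q O). intros x [i ->]. apply Hub.
  - exists (p O), O. reflexivity.
  - exists c. intro n. split.
    + apply Rlt_le_trans with (1 := Hp n). apply Hc1. now exists (S n).
    + apply Rle_lt_trans with (2 := Hq n). apply Hc2. intros x [i ->]. apply Hub.
Qed.

Lemma list_argmin (P : R -> Prop) (f : R -> R) (l : list R) :
  (exists x, In x l /\ P x) ->
  exists x, In x l /\ P x /\ forall y, In y l -> P y -> f x <= f y.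
Proof.
  induction l as [|z l IH]; intros [x [Hx HP]]; [destruct Hx|].
  destruct (classic (exists x, In x l /\ P x)) as [He|Hn].
  - destruct (IH He) as (u & Hu & HPu & Hmin).
    destruct (classic (P z /\ f z < f u)) as [[Hz Hlt]|Hz].
    + exists z. repeat split; auto; [now left|].
      intros y [<-|Hy] HPy; [lra|]. specialize (Hmin y Hy HPy). lra.
    + exists u. repeat split; auto; [now right|].
      intros y [<-|Hy] HPy; [|auto]. apply Rnot_lt_le. tauto.
  - destruct Hx as [<-|Hx]; [|elim Hn; now exists x].
    exists z. repeat split; auto; [now left|].
    intros y [<-|Hy] HPy; [lra|]. elim Hn. now exists y.
Qed.

Lemma list_bound (f : R -> R) (l : list R) :
  exists B, forall x, In x l -> f x <= B.
Proof.
  induction l as [|z l [B HB]].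
  - exists 0. intros x [].
  - exists (Rmax (f z) B). intros x [<-|Hx].
    + apply Rmax_l.
    + apply Rle_trans with (2 := Rmax_r _ _). auto.
Qed.

Lemma injective_seq_not_in_list (s : nat -> R) (l : list R) :
  (forall i j, s i = s j -> i = j) -> (forall n, In (s n) l) -> False.
Proof.
  intros Hinj Hin.
  assert (Hnd : NoDup (map s (seq 0 (S (length l))))).
  { apply NoDup_map_NoDup_ForallPairs; [|apply seq_NoDup].
    intros i j _ _. apply Hinj. }
  apply (NoDup_incl_length (l' := l)) in Hnd.
  - rewrite length_map, length_seq in Hnd. lia.
  - intros x Hx. apply in_map_iff in Hx. destruct Hx as (n & <- & _). apply Hin.
Qed.

(** The stages are indexed by a real [e], so that they can be uniformly definable; they grow as [e]
    decreases to 0. *)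
Definition finite_family (A : R -> R -> Prop) : Prop :=
  (forall e e' x, 0 < e' <= e -> A e x -> A e' x) /\
  (forall e, 0 < e -> exists l, forall x, A e x -> In x l).

Definition member (A : R -> R -> Prop) (x : R) : Prop := exists e, 0 < e /\ A e x.

(* [x] enters the growing sets [A e], as [e] decreases to [0], no later than [y]. *)
Definition earlier (A : R -> R -> Prop) (x y : R) : Prop :=
  forall e, 0 < e -> A e y -> A e x.

(* [m] is the distance from [a] to the other points present when [a] enters. *)
Definition gap (A : R -> R -> Prop) (a m : R) : Prop :=
  0 < m /\ (exists b, earlier A b a /\ (b = a + m \/ b = a - m)) /\
  (forall b, earlier A b a -> b <> a -> a + m <= b \/ b <= a - m).

(** The value [v] is m^4 / (c - a), multiplied out to be expressible by terms. *)
Definition code (A : R -> R -> Prop) (c v : R) : Prop :=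
  exists a m, member A a /\ gap A a m /\ a < c /\ c - a < m ^ 3 /\ v * (c - a) = m ^ 4.

(* For [c] in the window, [m ^ 4 / (c - a)] lies in [(K, K + 1/K)]. *)
Definition window_lo (a m K : R) : R := a + m ^ 4 * (K / (K * K + 1)).
Definition window_hi (a m K : R) : R := a + m ^ 4 / K.

(** For the last bound put u = m^4: the width is u / (K (K^2 + 1)) >= u / (2 K^3), while the cube is
    u^3 / K^3 with u <= 1/16. It leaves [next_state] room for the zones inside the window. *)
Lemma window_bounds a m K :
  1 <= K -> 0 < m <= 1 / 2 ->
  a < window_lo a m K < window_hi a m K /\ window_hi a m K <= a + m ^ 4 /\ m ^ 4 <= 1 / 16 /\
  6 * (window_hi a m K - a) ^ 3 <= window_hi a m K - window_lo a m K.
Proof.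
  intros HK Hm. unfold window_lo, window_hi.
  assert (H2 : 0 < m * m <= 1 / 4) by nra.
  assert (H4 : 0 < m ^ 4 <= 1 / 16).
  { replace (m ^ 4) with ((m * m) * (m * m)) by ring. nra. }
  set (u := m ^ 4) in *.
  assert (Hd : 0 < K * K + 1) by nra.
  assert (Ha : 0 < K / (K * K + 1)) by (apply Rdiv_lt_0_compat; lra).
  assert (Hb : 0 < / K <= 1).
  { split; [apply Rinv_0_lt_compat; lra|]. rewrite <- Rinv_1. apply Rinv_le_contravar; lra. }
  assert (Hab : / K - K / (K * K + 1) = / K * / (K * K + 1)) by (field; lra).
  assert (Hc : / (K * K + 1) >= / K * / K / 2).
  { apply Rle_ge. replace (/ K * / K / 2) with (/ (2 * (K * K))) by (field; lra).
    apply Rinv_le_contravar; nra. }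
  assert (Hi : 0 < / (K * K + 1)) by (apply Rinv_0_lt_compat; lra).
  set (b := / K) in *. change (u / K) with (u * b).
  assert (Hb2 : 0 < b * / (K * K + 1)) by (apply Rmult_lt_0_compat; lra).
  repeat split.
  - assert (0 < u * (K / (K * K + 1))) by (apply Rmult_lt_0_compat; lra). lra.
  - apply Rplus_lt_compat_l, Rmult_lt_compat_l; lra.
  - nra.
  - lra.
  - replace (a + u * b - (a + u * (K / (K * K + 1))))
      with (u * (b * / (K * K + 1))) by (rewrite <- Hab; ring).
    replace (6 * (a + u * b - a) ^ 3) with (u * (b * (6 * (u * u) * (b * b)))) by ring.
    apply Rmult_le_compat_l; [lra|]. apply Rmult_le_compat_l; [lra|].
    assert (u * u <= 1 / 256) by nra. assert (0 < b * b) by nra.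
    unfold Rdiv in Hc. nra.
Qed.

Section Coding.

Variable A : R -> R -> Prop.
Hypothesis A_finite : finite_family A.
Hypothesis A_range : forall e x, A e x -> 0 < x < 1 / 2.
Hypothesis A_dense : forall p q, 0 <= p < q -> q <= 1 / 2 ->
  exists x, member A x /\ p < x < q.

Lemma earlier_refl a : earlier A a a.
Proof. intros e _ H. exact H. Qed.

Lemma earlier_trans a b c : earlier A a b -> earlier A b c -> earlier A a c.
Proof. intros H1 H2 e He H. auto. Qed.

(** The stages form a chain, so one that contains [b] but not [a] settles the order. Points entering
    together are each earlier than the other. *)
Lemma earlier_total a b : earlier A a b \/ earlier A b a.
Proof.
  destruct (classic (earlier A a b)) as [H|H]; [now left|right].
  apply not_all_ex_not in H. destruct H as [e H].
  apply imply_to_and in H. destruct H as [He H].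
  apply imply_to_and in H. destruct H as [Hb Ha].
  intros e' He' Ha'. destruct (Rle_or_lt e' e).
  - apply (proj1 A_finite) with e; [lra|assumption].
  - elim Ha. apply (proj1 A_finite) with e'; [lra|assumption].
Qed.

Lemma member_range x : member A x -> 0 < x < 1 / 2.
Proof. intros (e & _ & H). exact (A_range e x H). Qed.

Lemma member_earlier a b : member A a -> earlier A b a -> member A b.
Proof. intros (e & He & Ha) H. exists e. auto. Qed.

Lemma earlier_finite a : member A a -> exists l, forall b, earlier A b a -> In b l.
Proof.
  intros (e & He & Ha). destruct (proj2 A_finite e He) as [l Hl].
  exists l. auto.
Qed.

(** A stage containing one witness is finite, so a first one can be picked inside it. *)
Lemma earliest (P : R -> Prop) :
  (exists x, member A x /\ P x) ->
  exists x, member A x /\ P x /\ forall y, member A y -> P y -> earlier A x y.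
Proof.
  intros (x0 & (e & He & Hx0) & HP0).
  destruct (proj2 A_finite e He) as [l Hl].
  assert (H : forall l, (exists x, In x l /\ A e x /\ P x) ->
    exists x, A e x /\ P x /\ forall y, In y l -> A e y -> P y -> earlier A x y).
  { clear l Hl. induction l as [|z l IH]; intros (x & Hx & HA & HP); [destruct Hx|].
    destruct (classic (exists x, In x l /\ A e x /\ P x)) as [Hex|Hn].
    - destruct (IH Hex) as (u & HAu & HPu & Hu).
      destruct (classic (A e z /\ P z /\ earlier A z u)) as [(HAz & HPz & Hz)|Hz].
      + exists z. repeat split; auto. intros y [<-|Hy] HAy HPy.
        * apply earlier_refl.
        * apply earlier_trans with u; auto.
      + exists u. repeat split; auto. intros y [<-|Hy] HAy HPy; [|auto].
        destruct (earlier_total u z); tauto.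
    - destruct Hx as [<-|Hx]; [|elim Hn; now exists x].
      exists z. repeat split; auto. intros y [<-|Hy] HAy HPy.
      + apply earlier_refl.
      + elim Hn. now exists y. }
  destruct (H l) as (x & HAx & HPx & Hx); [exists x0; auto|].
  exists x. repeat split; auto; [now exists e|].
  (* The choice is global: a point missing from stage [e] enters only at smaller indices, where [x]
     is already present. *)
  intros y (e1 & He1 & Hy1) HPy e' He' Hy.
  destruct (classic (A e y)) as [HAy|HAy].
  - apply (Hx y); auto.
  - apply (proj1 A_finite) with e; [|assumption]. split; [lra|].
    apply Rnot_lt_le. intro Hlt. apply HAy.
    apply (proj1 A_finite) with e'; [lra|assumption].
Qed.

Lemma gap_exists a b : member A a -> earlier A b a -> b <> a -> exists m, gap A a m.
Proof.
  intros Ha Hb Hne. destruct (earlier_finite a Ha) as [l Hl].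
  destruct (list_argmin (fun x => earlier A x a /\ x <> a) (fun x => Rabs (x - a)) l)
    as (x & _ & [Hx Hxa] & Hmin).
  - exists b. auto.
  - exists (Rabs (x - a)). split; [|split].
    + apply Rabs_pos_lt. lra.
    + exists x. split; [assumption|]. unfold Rabs. destruct Rcase_abs; lra.
    + intros y Hy Hya. specialize (Hmin y (Hl y Hy) (conj Hy Hya)).
      revert Hmin. unfold Rabs. destruct (Rcase_abs (x - a)), (Rcase_abs (y - a)); lra.
Qed.

Lemma gap_le_half a m : member A a -> gap A a m -> 0 < m <= 1 / 2.
Proof.
  intros Ha (Hm & (b & Hb & Hbm) & _).
  pose proof (member_range a Ha).
  pose proof (member_range b (member_earlier a b Ha Hb)). lra.
Qed.

Lemma gap_le_dist a m b : gap A a m -> earlier A b a ->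
  (b < a -> m <= a - b) /\ (a < b -> m <= b - a).
Proof.
  intros (Hm & _ & H) Hb. split; intro Hlt;
    (destruct (H b Hb); [lra|lra|lra]).
Qed.

Lemma cube_le x : 0 < x <= 1 / 2 -> 0 < x ^ 3 <= x / 4.
Proof.
  intro H. assert (0 < x * x <= 1 / 4) by nra. simpl. nra.
Qed.

Lemma cube_mono x y : 0 <= x <= y -> x ^ 3 <= y ^ 3.
Proof. intro H. apply pow_incr. exact H. Qed.

(* A state [(a, m)] consists of a point [a_k] of the coding sequence and [m(a_k)]. *)
Definition state_ok (s : R * R) : Prop :=
  member A (fst s) /\ gap A (fst s) (snd s) /\ fst s + snd s ^ 4 < 1 / 2.

(** The first two clauses nest the next window in the current one. The last makes the points left of
    a_{k+1} that enter strictly between a_k and a_{k+1} harmless: [c] will lie beyond their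
    zones. *)
Definition state_step (K : R) (s s' : R * R) : Prop :=
  window_lo (fst s) (snd s) K < fst s' /\ fst s' + snd s' ^ 4 < window_hi (fst s) (snd s) K /\
  forall b mb, member A b -> gap A b mb -> ~ earlier A b (fst s) ->
    earlier A b (fst s') -> ~ earlier A (fst s') b -> b < fst s' ->
    b + mb ^ 3 <= fst s'.

(* If no point of the window avoided all the zones [(b, b + m(b)^3)], every
   late point [x] would lie in the zone of an earlier [b], whence
   [m(x) <= x - b < m(b)^3]: the zones shrink so fast that together they
   cannot reach across the window. *)
Lemma next_state K s : 1 <= K -> state_ok s -> exists s', state_ok s' /\ state_step K s s'.
Proof.
  destruct s as [a m]. unfold state_ok, state_step. simpl fst. simpl snd.
  intros HK (Ha & Hgap & Hlt).
  pose proof (gap_le_half a m Ha Hgap) as Hm.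
  destruct (window_bounds a m K HK Hm) as ((Hp & Hpq) & Hq & Hm4 & Hkey).
  set (p := window_lo a m K) in *. set (q := window_hi a m K) in *.
  pose proof (member_range a Ha) as Har.
  (* The next point is sought left of [r]; the remaining third, at least 2 g^3 long, holds its own
     window. *)
  pose (r := p + 2 / 3 * (q - p)).
  assert (Hg : 0 < q - a <= 1 / 16) by lra.
  pose (g := q - a). fold g in Hkey, Hg.
  assert (Hg3 : 0 < g ^ 3) by (apply pow_lt; lra).
  assert (Hmm : m ^ 4 < m).
  { assert (m * m <= 1/4) by nra.
    replace (m ^ 4) with (m * (m * (m * m))) by ring. nra. }
  (* Such a point is nearer to [a] than [m], as q - a <= m^4 < m. *)
  assert (Hlate : forall x, a < x < q -> ~ earlier A x a).
  { intros x Hx Hxa. destruct (gap_le_dist a m x Hgap Hxa) as [_ H]. lra. }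
  assert (Hfirst : forall x, ~ earlier A x a -> earlier A a x).
  { intros x Hx. destruct (earlier_total a x); tauto. }
  assert (Hclean : exists x, member A x /\ p < x < r /\
    forall b mb, member A b -> gap A b mb -> ~ earlier A b a ->
      earlier A b x -> ~ earlier A x b -> b < x -> b + mb ^ 3 <= x).
  { apply NNPP. intro Hno.
    assert (Hbad : forall x, member A x -> p < x < r -> exists b mb,
      member A b /\ gap A b mb /\ ~ earlier A b a /\ earlier A b x /\
      ~ earlier A x b /\ b < x < b + mb ^ 3).
    { intros x Hx Hxr. apply NNPP. intro Hn. apply Hno. exists x.
      split; [assumption|split; [assumption|]].
      intros b mb H1 H2 H3 H4 H5 H6. apply Rnot_lt_le. intro H7.
      apply Hn. exists b, mb. tauto. }
    (* By [Hkey], 2 g^3 is at most a third of the window, so this interval is nonempty. Its point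
       [x0] shows that the minimization below has a candidate. *)
    destruct (A_dense (p + 2 * g ^ 3) r) as (x0 & Hx0 & Hx0r);
      [unfold r; lra|unfold r; lra|].
    assert (Hx0a : ~ earlier A x0 a) by (apply Hlate; unfold r in *; lra).
    destruct (gap_exists x0 a Hx0 (Hfirst x0 Hx0a)) as [m0 Hm0]; [lra|].
    (* Minimal counterexample: the first point whose doubled zone reaches beyond p + 2 g^3. It is
       not left of the window, since there mx <= x - a < g. *)
    destruct (earliest (fun x => a < x < r /\ ~ earlier A x a /\
      exists mx, gap A x mx /\ p + 2 * g ^ 3 < x + 2 * mx ^ 3))
      as (x & Hx & (Hxr & Hxa & mx & Hmx & Hxp) & Hmin).
    { exists x0. repeat split; try assumption; try lra.
      exists m0. split; [assumption|].
      pose proof (proj1 (gap_le_half x0 m0 Hx0 Hm0)) as H.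
      assert (0 < m0 ^ 3) by now apply pow_lt. lra. }
    pose proof (gap_le_half x mx Hx Hmx) as Hmx2.
    destruct (Rle_or_lt x p) as [Hxle|Hxgt].
    - destruct (gap_le_dist x mx a Hmx (Hfirst x Hxa)) as [H _].
      assert (mx ^ 3 <= g ^ 3) by (apply cube_mono; unfold g; lra). lra.
    - destruct (Hbad x Hx) as (b & mb & Hb & Hmb & Hba & Hbx & Hxb & Hz); [lra|].
      pose proof (gap_le_half b mb Hb Hmb) as Hmb2.
      pose proof (cube_le mb Hmb2) as Hc.
      assert (Hab : a < b).
      { destruct (Rtotal_order a b) as [H|[H|H]]; [assumption| |].
        - subst b. elim Hba. apply earlier_refl.
        - destruct (gap_le_dist b mb a Hmb (Hfirst b Hba)) as [_ H']. lra. }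
      destruct (Rlt_or_le (p + 2 * g ^ 3) (b + 2 * mb ^ 3)) as [H|H].
      + apply Hxb. apply Hmin; [assumption|]. repeat split; try assumption; [lra|].
        now exists mb.
      (* Here mx <= x - b < mb^3, so x + 2 mx^3 <= x + mx / 2 < b + 2 mb^3 <= p + 2 g^3, against the
         choice of [x]. *)
      + destruct (gap_le_dist x mx b Hmx Hbx) as [H' _].
        assert (mx ^ 3 <= mx / 4) by (apply cube_le; lra). lra. }
  destruct Hclean as (x & Hx & Hxr & Hcl).
  assert (Hxa : ~ earlier A x a) by (apply Hlate; unfold r in *; lra).
  destruct (gap_exists x a Hx (Hfirst x Hxa)) as [mx Hmx]; [lra|].
  pose proof (gap_le_half x mx Hx Hmx) as Hmx2.
  destruct (gap_le_dist x mx a Hmx (Hfirst x Hxa)) as [Hd _].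
  assert (Hmx4 : mx ^ 4 <= g ^ 3).
  { assert (H3 : mx ^ 3 <= g ^ 3) by (apply cube_mono; unfold r, g in *; lra).
    pose proof (cube_le mx Hmx2). replace (mx ^ 4) with (mx * mx ^ 3) by ring. nra. }
  exists (x, mx). simpl fst. simpl snd. unfold r in Hxr.
  split; [split; [assumption|split; [assumption|lra]]|].
  split; [lra|split; [lra|exact Hcl]].
Qed.

(** Of two points below 1/4, the later one has a gap m with m^4 <= 1/16. *)
Lemma initial_state : exists s, state_ok s.
Proof.
  destruct (A_dense 0 (1 / 8)) as (x & Hx & Hxr); [lra|lra|].
  destruct (A_dense (1 / 8) (1 / 4)) as (y & Hy & Hyr); [lra|lra|].
  assert (H : forall a b, member A a -> earlier A b a -> b <> a -> a < 1 / 4 ->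
    exists s, state_ok s).
  { intros a b Ha Hb Hne Hlt. destruct (gap_exists a b Ha Hb Hne) as [m Hm].
    exists (a, m). split; [assumption|split; [assumption|]]. simpl fst. simpl snd.
    pose proof (gap_le_half a m Ha Hm) as Hm2.
    destruct (window_bounds a m 1 (Rle_refl 1) Hm2) as (_ & _ & H & _). lra. }
  destruct (earlier_total x y) as [Hxy|Hxy].
  - apply (H y x); auto; lra.
  - apply (H x y); auto; lra.
Qed.

(** The real [c] is common to all windows, so each a_n yields a value near n + 1. Conversely, a
    point with a large code value enters after a_0, and comparison with the first a_{n+1} that it
    precedes forces equality. *)
Lemma code_integers :
  exists c B,
    (forall n : nat, exists v, code A c v /\ INR n + 1 <= v <= INR n + 1 + / (INR n + 1)) /\
    (forall v, code A c v -> B < v ->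
       exists n : nat, INR n + 1 <= v <= INR n + 1 + / (INR n + 1)).
Proof.
  destruct initial_state as [s0 Hs0].
  destruct (dependent_choice _ state_ok (fun n => state_step (INR n + 1)) s0 Hs0)
    as [s Hs].
  { intros n x Hx. apply next_state; [|assumption]. pose proof (pos_INR n). lra. }
  pose (a n := fst (s n)). pose (m n := snd (s n)). pose (K n := INR n + 1).
  assert (HK : forall n, 1 <= K n) by (intro n; unfold K; pose proof (pos_INR n); lra).
  assert (Ha : forall n, member A (a n)) by (intro n; apply (proj1 (Hs n))).
  assert (Hm : forall n, gap A (a n) (m n)) by (intro n; apply (proj1 (Hs n))).
  assert (Hm2 : forall n, 0 < m n <= 1 / 2)
    by (intro n; apply (gap_le_half (a n)); auto).
  assert (Hbd : forall n, a n < window_lo (a n) (m n) (K n) < window_hi (a n) (m n) (K n) /\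
     window_hi (a n) (m n) (K n) <= a n + m n ^ 4).
  { intro n. destruct (window_bounds (a n) (m n) (K n) (HK n) (Hm2 n)) as (H1 & H2 & _).
    tauto. }
  assert (Hst : forall n, state_step (K n) (a n, m n) (a (S n), m (S n))).
  { intro n. unfold a, m. rewrite <- !surjective_pairing. apply (Hs n). }
  clear Hs. unfold state_step in Hst. simpl fst in Hst. simpl snd in Hst.
  destruct (nested_intervals_point (fun n => window_lo (a n) (m n) (K n))
    (fun n => window_hi (a n) (m n) (K n))) as [c Hc].
  { intro n. destruct (Hst n) as (H1 & H2 & _). pose proof (Hbd (S n)). lra. }
  { intro n. destruct (Hst n) as (H1 & H2 & _). pose proof (Hbd (S n)). lra. }
  { intro n. pose proof (Hbd n). lra. }
  assert (Hval : forall n v, v * (c - a n) = m n ^ 4 -> K n <= v <= K n + / K n).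
  { intros n v Hv. specialize (HK n). specialize (Hc n). pose proof (Hbd n) as Hb.
    unfold window_lo, window_hi in *. set (d := c - a n) in *.
    assert (Hd : 0 < d) by (unfold d; lra).
    assert (H1 : d < v * d / K n) by (rewrite Hv; unfold d; lra).
    assert (H2 : v * d * (K n / (K n * K n + 1)) < d) by (rewrite Hv; unfold d; lra).
    split.
    - apply (Rmult_lt_compat_r (K n)) in H1; [|lra].
      replace (v * d / K n * K n) with (v * d) in H1 by (field; lra). nra.
    - assert (H3 : v < K n + / K n); [|lra].
      apply (Rmult_lt_compat_r ((K n * K n + 1) / K n)) in H2;
        [|apply Rdiv_lt_0_compat; nra].
      replace (v * d * (K n / (K n * K n + 1)) * ((K n * K n + 1) / K n))
        with (v * d) in H2 by (field; split; nra).
      replace ((K n * K n + 1) / K n) with (K n + / K n) in H2 by (field; lra). nra. }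
  destruct (earlier_finite (a O) (Ha O)) as [l Hl].
  destruct (list_bound (fun b => / (c - b)) l) as [B HB].
  exists c, B. split.
  - intro n. pose proof (Hbd n) as Hb. specialize (Hc n).
    exists (m n ^ 4 / (c - a n)).
    assert (Hv : m n ^ 4 / (c - a n) * (c - a n) = m n ^ 4) by (field; lra).
    split; [|exact (Hval n _ Hv)].
    exists (a n), (m n). repeat split; auto; try lra; try apply Hm.
    pose proof (cube_le (m n) (Hm2 n)). specialize (Hm2 n).
    replace (m n ^ 4) with (m n * m n ^ 3) in Hb by ring. nra.
  - intros v (b & mb & Hb & Hmb & Hbc & Hz & Hv) HBv.
    pose proof (gap_le_half b mb Hb Hmb) as Hmb2.
    pose proof (cube_le mb Hmb2) as Hmb3.
    (* The finitely many points no later than a_0 give values below 1 / (c - b) <= B. *)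
    assert (H0 : ~ earlier A b (a O)).
    { intro H. specialize (HB b (Hl b H)).
      assert (Hlt : / (c - b) < v) by lra.
      apply (Rmult_lt_compat_r (c - b)) in Hlt; [|lra].
      rewrite Hv, Rinv_l in Hlt by lra.
      replace (mb ^ 4) with (mb * mb ^ 3) in Hlt by ring. nra. }
    (* Otherwise all a_n, which are distinct, would lie in a finite stage containing [b]. *)
    assert (Hex : exists n, earlier A b (a n)).
    { apply NNPP. intro Hn. destruct Hb as (e & He & HAb).
      destruct (proj2 A_finite e He) as [l' Hl'].
      apply (injective_seq_not_in_list a l').
      - assert (Hinc : forall i k, a i < a (S (i + k))).
        { intros i k. induction k as [|k IH].
          - rewrite Nat.add_0_r. destruct (Hst i) as (H1 & _). pose proof (Hbd i). lra.
          - rewrite Nat.add_succ_r. destruct (Hst (S (i + k))) as (H1 & _).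
            pose proof (Hbd (S (i + k))). lra. }
        intros i j Hij. destruct (Nat.lt_trichotomy i j) as [H|[H|H]]; [|assumption|].
        + specialize (Hinc i (j - i - 1)%nat).
          replace (S (i + (j - i - 1))) with j in Hinc by lia. lra.
        + specialize (Hinc j (i - j - 1)%nat).
          replace (S (j + (i - j - 1))) with i in Hinc by lia. lra.
      - intro n. apply Hl'. destruct (earlier_total (a n) b) as [H|H].
        + now apply H.
        + elim Hn. now exists n. }
    assert (Hn : exists n, ~ earlier A b (a n) /\ earlier A b (a (S n))).
    { destruct Hex as [n Hn]. induction n as [|n IH]; [contradiction|].
      destruct (classic (earlier A b (a n))); [auto|now exists n]. }
    destruct Hn as (n & Hn1 & Hn2).
    destruct (Hst n) as (_ & _ & Hcl).
    pose proof (Hc (S n)) as Hcn. pose proof (Hbd (S n)) as Hbn.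
    (* Left of a_{n+1}, a tie would put a_{n+1}, hence [c], at distance at least [mb] from [b], and
       otherwise the last clause of [state_step] ends the zone before [c]. Right of it, [b] is
       beyond [c] by the gap of a_{n+1}. *)
    destruct (Rtotal_order b (a (S n))) as [Hlt|[->|Hgt]].
    + exfalso. destruct (classic (earlier A (a (S n)) b)) as [He|He].
      * destruct (gap_le_dist b mb (a (S n)) Hmb He) as [_ H]. lra.
      * specialize (Hcl b mb Hb Hmb Hn1 Hn2 He Hlt). lra.
    + exists (S n). apply Hval.
      assert (mb = m (S n)) as <-; [|assumption].
      destruct Hmb as (Q1 & (x & Q2 & Q3) & Q4).
      destruct (Hm (S n)) as (P1 & (y & P2 & P3) & P4).
      destruct (Q4 y P2), (P4 x Q2); lra.
    + exfalso. destruct (gap_le_dist (a (S n)) (m (S n)) b (Hm (S n)) Hn2) as [_ H].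
      pose proof (cube_le (m (S n)) (Hm2 (S n))). specialize (Hm2 (S n)).
      replace (m (S n) ^ 4) with (m (S n) * m (S n) ^ 3) in Hbn by ring. nra.
Qed.

End Coding.

(** Far out, [V] clusters at the integers with errors tending to 0. A translation almost preserving
    it is thus a limit of integers, hence an integer; an integer translation moves clusters to
    clusters. *)
Lemma near_integers (V : R -> Prop) (B : R) :
  (forall n : nat, exists v, V v /\ INR n + 1 <= v <= INR n + 1 + / (INR n + 1)) ->
  (forall v, V v -> B < v ->
     exists n : nat, INR n + 1 <= v <= INR n + 1 + / (INR n + 1)) ->
  forall x, (forall eps, 0 < eps -> exists C, forall v, V v -> C < v ->
               exists w, V w /\ - eps < w - v - x < eps) <-> Zset x.
Proof.
  intros H1 H2 x.
  assert (Hsmall : forall eps, 0 < eps -> forall y, / eps < y -> 0 < / y < eps).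
  { intros eps He y Hy. assert (0 < / eps) by now apply Rinv_0_lt_compat.
    split; [apply Rinv_0_lt_compat; lra|].
    rewrite <- (Rinv_inv eps). apply Rinv_lt_contravar; [|assumption]. nra. }
  split.
  - intro H.
    assert (Happ : forall eps, 0 < eps -> exists z : Z, - eps < x - IZR z < eps).
    { intros eps He. destruct (H (eps / 4)) as [C HC]; [lra|].
      (* Large enough for v > C and w > B, and for both cluster errors to be below eps / 4. *)
      destruct (INR_unbounded (Rabs B + Rabs C + Rabs x + / (eps / 4) + eps + 2)) as [n Hn].
      pose proof (Rabs_pos B). pose proof (Rabs_pos C). pose proof (Rabs_pos x).
      pose proof (Rle_abs B). pose proof (Rle_abs C).
      pose proof (Rle_abs (- x)) as Hx. rewrite Rabs_Ropp in Hx.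
      assert (0 < / (eps / 4)) by (apply Rinv_0_lt_compat; lra).
      destruct (H1 n) as (v & Hv & Hvn).
      destruct (HC v Hv) as (w & Hw & Hwv); [lra|].
      destruct (H2 w Hw) as [j Hj]; [lra|].
      assert (Hj1 : / (INR j + 1) <= 1).
      { rewrite <- Rinv_1. apply Rinv_le_contravar; [lra|]. pose proof (pos_INR j). lra. }
      destruct (Hsmall (eps / 4)) with (y := INR j + 1) as [_ Hj2]; [lra|lra|].
      destruct (Hsmall (eps / 4)) with (y := INR n + 1) as [_ Hn2]; [lra|lra|].
      exists (Z.of_nat j - Z.of_nat n)%Z. rewrite minus_IZR, <- !INR_IZR_INZ. lra. }
    destruct (base_Int_part x) as [Hi1 Hi2].
    destruct (Req_dec x (IZR (Int_part x))) as [He|Hne]; [now exists (Int_part x)|].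
    exfalso. set (i := Int_part x) in *.
    (* No integer is closer to [x] than the nearer of its two neighbours. *)
    destruct (Happ (Rmin (x - IZR i) (IZR i + 1 - x))) as [z Hz].
    { apply Rmin_glb_lt; lra. }
    pose proof (Rmin_l (x - IZR i) (IZR i + 1 - x)).
    pose proof (Rmin_r (x - IZR i) (IZR i + 1 - x)).
    destruct (Z.lt_ge_cases i z) as [Hiz|Hiz].
    + assert (Hle : (i + 1 <= z)%Z) by lia. apply IZR_le in Hle.
      rewrite plus_IZR in Hle. lra.
    + apply IZR_le in Hiz. lra.
  - intros [z ->] eps He.
    assert (0 < / eps) by now apply Rinv_0_lt_compat.
    exists (Rabs B + Rabs (IZR z) + / eps + 2).
    pose proof (Rle_abs B). pose proof (Rabs_pos B). pose proof (Rabs_pos (IZR z)).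
    pose proof (Rle_abs (- IZR z)) as Hz. rewrite Rabs_Ropp in Hz.
    intros v Hv Hvb. destruct (H2 v Hv) as [n Hn]; [lra|].
    assert (Hn1 : / (INR n + 1) <= 1).
    { rewrite <- Rinv_1. apply Rinv_le_contravar; [lra|]. pose proof (pos_INR n). lra. }
    assert (Hpos : (0 <= Z.of_nat n + z)%Z).
    { apply le_IZR. rewrite plus_IZR, <- INR_IZR_INZ. lra. }
    destruct (H1 (Z.to_nat (Z.of_nat n + z))) as (w & Hw & Hwn).
    rewrite (INR_IZR_INZ (Z.to_nat _)), Z2Nat.id, plus_IZR, <- INR_IZR_INZ in Hwn
      by assumption.
    destruct (Hsmall eps He (INR n + 1)) as [_ Hn2]; [lra|].
    destruct (Hsmall eps He (INR n + IZR z + 1)) as [_ Hj2]; [lra|].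
    exists w. split; [assumption|]. lra.
Qed.

(** The criterion of [near_integers], applied to the codes, quantifies over reals only and has [c]
    as a parameter, so it is first-order. *)
Theorem dense_family_defines_Z (M : expansion) (A : R -> R -> Prop) :
  definable2 M A -> finite_family A -> (forall e x, A e x -> 0 < x < 1 / 2) ->
  (forall p q, 0 <= p < q -> q <= 1 / 2 -> exists x, member A x /\ p < x < q) ->
  definable M Zset.
Proof.
  intros HA Hfin Hrange Hdense.
  destruct (code_integers A Hfin Hrange Hdense) as (c & B & H1 & H2).
  pose proof (near_integers _ B H1 H2) as HZ.
  apply definable1_definable. intros f Hf.
  eapply definable_pred_ext; [intro v; apply (HZ (f v))|].
  unfold code, gap, member, earlier. definable_tac.
Qed.

(** * Packing numbers and gaps *)

Lemma Rabs_le_bounds x a : Rabs x <= a -> - a <= x <= a.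
Proof. unfold Rabs. destruct Rcase_abs; lra. Qed.

Lemma NoDup_list_prod (S T : Type) (l : list S) (l' : list T) :
  NoDup l -> NoDup l' -> NoDup (list_prod l l').
Proof.
  intros Hl Hl'. induction Hl as [|x l Hx Hl IH]; simpl; [constructor|].
  apply NoDup_app; [|assumption|].
  - apply NoDup_map_NoDup_ForallPairs; [|assumption]. intros y y' _ _ H. congruence.
  - intros u Hu Hu'. apply in_map_iff in Hu. destruct Hu as (y & <- & _).
    apply in_prod_iff in Hu'. tauto.
Qed.

Definition separated (s : R) (l : list R) : Prop :=
  NoDup l /\ forall x y, In x l -> In y l -> x <> y -> s <= Rabs (x - y).

(** Pigeonhole: cut [-L, L] into cells of length [s]; distinct points have distinct cell numbers
    [f x]. *)
Lemma separated_length s L l :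
  0 < s -> 0 <= L -> separated s l -> (forall x, In x l -> Rabs x <= L) ->
  INR (length l) <= 2 * L / s + 1.
Proof.
  intros Hs HL [Hnd Hsep] Hb.
  pose (f x := Z.to_nat (Int_part ((x + L) / s))).
  pose (N := Z.to_nat (Int_part (2 * L / s))).
  assert (Hint : forall y, 0 <= y -> (0 <= Int_part y)%Z).
  { intros y Hy. destruct (base_Int_part y) as [_ H].
    assert (-1 < Int_part y)%Z; [|lia]. apply lt_IZR. lra. }
  assert (Hpos : forall x, In x l -> 0 <= (x + L) / s).
  { intros x Hx. specialize (Hb x Hx). apply Rabs_le_bounds in Hb.
    apply Rle_mult_inv_pos; lra. }
  assert (HfN : forall x, In x l -> (f x <= N)%nat).
  { intros x Hx. unfold f, N. apply Z2Nat.inj_le.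
    - apply Hint; auto.
    - apply Hint. apply Rle_mult_inv_pos; lra.
    - assert (Int_part ((x + L) / s) < Int_part (2 * L / s) + 1)%Z; [|lia].
      apply lt_IZR. rewrite plus_IZR.
      destruct (base_Int_part ((x + L) / s)) as [H1 _].
      destruct (base_Int_part (2 * L / s)) as [_ H2].
      assert ((x + L) / s <= 2 * L / s).
      { apply Rmult_le_compat_r; [left; now apply Rinv_0_lt_compat|].
        specialize (Hb x Hx). apply Rabs_le_bounds in Hb. lra. }
      lra. }
  assert (Hndf : NoDup (map f l)).
  { apply NoDup_map_NoDup_ForallPairs; [|assumption].
    intros x y Hx Hy Hf. apply NNPP. intro Hne.
    specialize (Hsep x y Hx Hy Hne). unfold f in Hf.
    apply Z2Nat.inj in Hf; [|apply Hint; auto|apply Hint; auto].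
    destruct (base_Int_part ((x + L) / s)) as [H1 H2].
    destruct (base_Int_part ((y + L) / s)) as [H3 H4].
    rewrite Hf in H1, H2.
    assert (Hd : -1 < (x + L) / s - (y + L) / s < 1) by lra.
    replace ((x + L) / s - (y + L) / s) with ((x - y) / s) in Hd by (field; lra).
    assert (Hxy : x - y = (x - y) / s * s) by (field; lra).
    assert (Rabs (x - y) < s); [|lra].
    rewrite Hxy. apply Rabs_def1; nra. }
  apply (NoDup_incl_length (l' := seq 0 (S N))) in Hndf.
  - rewrite length_map, length_seq in Hndf. apply le_INR in Hndf. rewrite S_INR in Hndf.
    unfold N in Hndf. rewrite (INR_IZR_INZ (Z.to_nat _)), Z2Nat.id in Hndf
      by (apply Hint; apply Rle_mult_inv_pos; lra).
    destruct (base_Int_part (2 * L / s)) as [H _]. lra.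
  - intros k Hk. apply in_map_iff in Hk. destruct Hk as (x & <- & Hx).
    apply in_seq. specialize (HfN x Hx). lia.
Qed.

(** Otherwise points could be added forever, against [separated_length]. *)
Lemma separated_set_finite (P : R -> Prop) s L :
  0 < s -> 0 <= L -> (forall x, P x -> Rabs x <= L) ->
  (forall x y, P x -> P y -> x <> y -> s <= Rabs (x - y)) ->
  exists l, forall x, P x -> In x l.
Proof.
  intros Hs HL Hb Hsep. apply NNPP. intro Hinf.
  assert (Hlong : forall n, exists l, NoDup l /\ (forall x, In x l -> P x) /\ length l = n).
  { induction n as [|n (l & Hnd & HP & Hlen)].
    - exists []. repeat split; [constructor|intros x []].
    - destruct (not_all_ex_not _ _ (not_ex_all_not _ _ Hinf l)) as [x Hx].
      apply imply_to_and in Hx. destruct Hx as [HPx Hx].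
      exists (x :: l). repeat split.
      + now constructor.
      + intros y [<-|Hy]; auto.
      + simpl. now rewrite Hlen. }
  destruct (INR_unbounded (2 * L / s + 1)) as [n Hn].
  destruct (Hlong n) as (l & Hnd & HP & Hlen).
  assert (INR (length l) <= 2 * L / s + 1); [|rewrite Hlen in *; lra].
  apply separated_length; auto. split; auto.
Qed.

(** A first-order form of [adherence], which quantifies over neighbourhoods. *)
Definition adherent (E : R -> Prop) (x : R) : Prop :=
  forall e, 0 < e -> exists y, E y /\ x - e < y < x + e.

Definition gap_ends (E : R -> Prop) (e x : R) : Prop :=
  adherent E x /\ forall y, E y -> ~ (x < y < x + e).

Lemma adherent_adherence E x : adherent E x -> adherence E x.
Proof.
  intros H V [d Hd]. destruct (H d (cond_pos d)) as (y & Hy & Hxy).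
  exists y. split; [|assumption]. apply Hd. unfold disc. apply Rabs_def1; lra.
Qed.

Lemma nowhere_dense_hole E p q :
  nowhere_dense E -> p < q -> exists z, p < z < q /\ ~ adherent E z.
Proof.
  intros HE Hpq. apply NNPP. intro Hn. apply (HE ((p + q) / 2)).
  assert (Hd : 0 < (q - p) / 2) by lra.
  exists (mkposreal _ Hd). intros z Hz. unfold disc in Hz. simpl in Hz.
  apply Rabs_def2 in Hz. apply adherent_adherence. apply NNPP. intro Hz'.
  apply Hn. exists z. split; [lra|assumption].
Qed.

(** Pick a point [p] outside the closure just right of [z]; the greatest closure point below [p] is
    a gap end. *)
Lemma gap_ends_dense E z eta :
  nowhere_dense E -> adherent E z -> 0 < eta ->
  exists x, member (gap_ends E) x /\ z <= x < z + eta.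
Proof.
  intros HE Hz Heta.
  destruct (nowhere_dense_hole E z (z + eta) HE) as (p & Hp & Hnp); [lra|].
  destruct (completeness (fun u => adherent E u /\ u <= p)) as [x [Hx1 Hx2]].
  - exists p. intros u [_ Hu]. exact Hu.
  - exists z. split; [assumption|lra].
  - assert (Hzx : z <= x) by (apply Hx1; split; [assumption|lra]).
    assert (Hxp : x <= p) by (apply Hx2; intros u [_ Hu]; exact Hu).
    assert (Hax : adherent E x).
    { intros e He. apply NNPP. intro Hn. assert (x <= x - e / 2); [|lra].
      apply Hx2. intros u [Hu Hup]. apply Rnot_lt_le. intro Hlt.
      assert (u <= x) by (apply Hx1; now split).
      destruct (Hu (e / 2)) as (y & Hy & Hyu); [lra|].
      apply Hn. exists y. split; [assumption|lra]. }
    assert (x <> p) by (intros ->; contradiction).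
    exists x. split; [|lra]. exists (p - x). split; [lra|].
    split; [assumption|]. intros y Hy Hxy.
    assert (y <= x); [|lra]. apply Hx1. split; [|lra].
    intros e He. exists y. split; [assumption|lra].
Qed.

Lemma adherent_bounded E L :
  (forall x, E x -> Rabs x <= L) -> forall x, adherent E x -> Rabs x <= L + 1.
Proof.
  intros HL x Hx. destruct (Hx 1) as (y & Hy & Hxy); [lra|].
  specialize (HL y Hy). apply Rabs_le_bounds in HL. apply Rabs_le. lra.
Qed.

(** Two left ends of gaps of length at least [e] are at least [e] apart. *)
Lemma gap_ends_finite_family E L :
  0 <= L -> (forall x, E x -> Rabs x <= L) -> finite_family (gap_ends E).
Proof.
  intros HL0 HL. split.
  - intros e e' x He [Hx H]. split; [assumption|]. intros y Hy Hxy.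
    apply (H y Hy). lra.
  - intros e He. apply separated_set_finite with (s := e) (L := L + 1); try lra.
    + intros x [Hx _]. now apply (adherent_bounded E).
    + assert (H : forall x y, gap_ends E e x -> gap_ends E e y -> x < y -> x + e <= y).
      { intros x y [_ Hx] [Hy _] Hxy. apply Rnot_lt_le. intro Hlt.
        destruct (Hy (Rmin (y - x) (x + e - y))) as (u & Hu & Huy).
        - apply Rmin_glb_lt; lra.
        - pose proof (Rmin_l (y - x) (x + e - y)). pose proof (Rmin_r (y - x) (x + e - y)).
          apply (Hx u Hu). lra. }
      intros x y Hx Hy Hne. destruct (Rtotal_order x y) as [Hlt|[Heq|Hlt]].
      * specialize (H x y Hx Hy Hlt). rewrite Rabs_left; lra.
      * contradiction.
      * specialize (H y x Hy Hx Hlt). rewrite Rabs_right; lra.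
Qed.

Lemma member_two F x y :
  finite_family F -> member F x -> member F y -> exists e, 0 < e /\ F e x /\ F e y.
Proof.
  intros [HF _] (e1 & He1 & Hx) (e2 & He2 & Hy).
  assert (0 < Rmin e1 e2) by (apply Rmin_glb_lt; lra).
  pose proof (Rmin_l e1 e2). pose proof (Rmin_r e1 e2).
  exists (Rmin e1 e2). repeat split; [assumption|apply HF with e1|apply HF with e2]; auto.
Qed.

(** Greedy choice: while fewer than [n] centres are chosen, their balls cannot cover [E], so some
    gap end is farther than [r] from all of them. *)
Lemma gap_ends_cover E r n :
  0 < r -> nowhere_dense E -> cover_number E r n ->
  exists l, separated r l /\ (forall x, In x l -> member (gap_ends E) x) /\ length l = n.
Proof.
  intros Hr HE [_ Hmin].
  assert (H : forall k, (k <= n)%nat -> exists l, separated r l /\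
    (forall x, In x l -> member (gap_ends E) x) /\ length l = k).
  { induction k as [|k IH]; intro Hk.
    - exists []. repeat split; [constructor|intros x y []|intros x []].
    - destruct IH as (l & [Hnd Hsep] & Hl & Hlen); [lia|].
      assert (Hex : exists x, member (gap_ends E) x /\ forall c, In c l -> r < Rabs (x - c)).
      { apply NNPP. intro Hn. apply (Hmin k); [lia|].
        (* Only indices below k, the length of [l], count; the default 0 is never a centre. *)
        exists (fun i => nth i l 0). intros y Hy.
        assert (Hay : adherent E y) by (intros e He; exists y; split; [assumption|lra]).
        assert (Hnear : exists c, In c l /\ Rabs (y - c) <= r).
        { apply NNPP. intro Hfar.
          assert (Hcl : forall x, member (gap_ends E) x ->
            exists c, In c l /\ Rabs (x - c) <= r).
          { intros x Hx. apply NNPP. intro Hx'. apply Hn. exists x. split; [assumption|].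
            intros c Hc. apply Rnot_le_lt. intro. apply Hx'. now exists c. }
          destruct (gap_ends_dense E y 1 HE Hay) as (x0 & Hx0 & _); [lra|].
          destruct (Hcl x0 Hx0) as (c0 & Hc0 & _).
          destruct (list_argmin (fun _ => True) (fun c => Rabs (y - c)) l)
            as (c1 & Hc1 & _ & Hc1min); [now exists c0|].
          assert (Hd : r < Rabs (y - c1)).
          { apply Rnot_le_lt. intro. apply Hfar. now exists c1. }
          (* If even the nearest centre [c1] is farther than [r] from [y], so are all centres from
             gap ends close to [y]. *)
          destruct (gap_ends_dense E y (Rabs (y - c1) - r) HE Hay) as (x & Hx & Hxy);
            [lra|].
          destruct (Hcl x Hx) as (c & Hc & Hxc). specialize (Hc1min c Hc I).
          pose proof (Rabs_triang (y - x) (x - c)) as Ht.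
          replace (y - x + (x - c)) with (y - c) in Ht by ring.
          assert (Rabs (y - x) < Rabs (y - c1) - r) by (apply Rabs_def1; lra). lra. }
        destruct Hnear as (c & Hc & Hyc). destruct (In_nth l c 0 Hc) as (i & Hi & <-).
        exists i. split; [lia|assumption]. }
      destruct Hex as (x & Hx & Hfar).
      exists (x :: l). repeat split.
      + constructor; [|assumption]. intro Hin. specialize (Hfar x Hin).
        rewrite Rminus_diag, Rabs_R0 in Hfar. lra.
      + intros u w [<-|Hu] [<-|Hw] Hne; auto.
        * now elim Hne.
        * left. auto.
        * left. rewrite Rabs_minus_sym. auto.
      + intros u [<-|Hu]; auto.
      + simpl. now rewrite Hlen. }
  destruct (H n) as [l Hl]; [lia|]. now exists l.
Qed.

(** * Difference quotients and shears *)

Definition shear (t : R) (F : R -> R -> Prop) (e z : R) : Prop :=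
  exists x y, F e x /\ F e y /\ z = x - t * y.

Definition quotients (F : R -> R -> Prop) (e z : R) : Prop :=
  (0 < z /\ z < 1 / 2) /\
  exists a b c d, F e a /\ F e b /\ F e c /\ F e d /\ ~ c = d /\ z * (c - d) = a - b.

Lemma shear_finite_family t F : finite_family F -> finite_family (shear t F).
Proof.
  intros [Hmono Hfin]. split.
  - intros e e' z He (x & y & Hx & Hy & ->). exists x, y.
    repeat split; eauto.
  - intros e He. destruct (Hfin e He) as [l Hl].
    exists (map (fun u => fst u - t * snd u) (list_prod l l)).
    intros z (x & y & Hx & Hy & ->). apply in_map_iff. exists (x, y).
    split; [reflexivity|]. apply in_prod; auto.
Qed.

Lemma quotients_finite_family F : finite_family F -> finite_family (quotients F).
Proof.
  intros [Hmono Hfin]. split.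
  - intros e e' z He (Hz & a & b & c & d & Ha & Hb & Hc & Hd & Hcd & Heq).
    split; [assumption|]. exists a, b, c, d. repeat split; eauto.
  - intros e He. destruct (Hfin e He) as [l Hl].
    exists (map (fun u => (fst (fst u) - snd (fst u)) / (fst (snd u) - snd (snd u)))
      (list_prod (list_prod l l) (list_prod l l))).
    intros z (Hz & a & b & c & d & Ha & Hb & Hc & Hd & Hcd & Heq).
    apply in_map_iff. exists ((a, b), (c, d)). split.
    + simpl. rewrite <- Heq. field. lra.
    + apply in_prod; apply in_prod; auto.
Qed.

(** By [dense_family_defines_Z] the quotients miss an interval (p, q); take [t] its midpoint and
    [eta] half its length. A violation would put (x - x') / (y - y') into (p, q). *)
Lemma quotients_gap M F :
  definable2 M F -> finite_family F -> ~ definable M Zset ->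
  exists t eta, 0 < eta <= 1 /\ forall x x' y y', member F x -> member F x' ->
    member F y -> member F y' ->
    eta * Rabs (y - y') <= Rabs ((x - x') - t * (y - y')).
Proof.
  intros HF Hfin HZ.
  assert (Hhole : exists p q, 0 <= p < q /\ q <= 1 / 2 /\
    forall x, member (quotients F) x -> ~ (p < x < q)).
  { apply NNPP. intro Hn. apply HZ. apply (dense_family_defines_Z M (quotients F)).
    - unfold quotients. definable_tac.
    - now apply quotients_finite_family.
    - intros e x [Hx _]. exact Hx.
    - intros p q Hp Hq. apply NNPP. intro Hnx. apply Hn. exists p, q.
      split; [assumption|split; [assumption|]]. intros x Hx Hxpq. apply Hnx.
      now exists x. }
  destruct Hhole as (p & q & Hpq & Hq & Hhole).
  exists ((p + q) / 2), ((q - p) / 2). split; [lra|].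
  intros x x' y y' Hx Hx' Hy Hy'. apply Rnot_lt_le. intro Hlt.
  destruct (Req_dec y y') as [<-|Hne].
  { pose proof (Rabs_pos (x - x' - (p + q) / 2 * (y - y))).
    rewrite (Rminus_diag y), Rabs_R0 in *. lra. }
  set (z := (x - x') / (y - y')).
  assert (Hz : z * (y - y') = x - x') by (unfold z; field; lra).
  assert (Hzpq : p < z < q).
  { rewrite <- Hz in Hlt.
    replace (z * (y - y') - (p + q) / 2 * (y - y')) with ((z - (p + q) / 2) * (y - y'))
      in Hlt by ring.
    rewrite Rabs_mult in Hlt. apply Rmult_lt_reg_r in Hlt; [|apply Rabs_pos_lt; lra].
    apply Rabs_def2 in Hlt. lra. }
  apply (Hhole z); [|assumption].
  destruct (member_two F x x' Hfin Hx Hx') as (e1 & He1 & H1 & H2).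
  destruct (member_two F y y' Hfin Hy Hy') as (e2 & He2 & H3 & H4).
  assert (0 < Rmin e1 e2) by (apply Rmin_glb_lt; lra).
  pose proof (Rmin_l e1 e2). pose proof (Rmin_r e1 e2). pose proof (proj1 Hfin) as Hmono.
  exists (Rmin e1 e2). split; [assumption|]. split; [lra|].
  exists x, x', y, y'. repeat split; eauto.
Qed.

(** Each shear squares the number of separated points and costs only a factor [eta] in the
    separation. The constants depend on [j] but not on [r]. *)
Lemma separated_power M E L :
  definable M E -> 0 <= L -> (forall x, E x -> Rabs x <= L) -> nowhere_dense E ->
  ~ definable M Zset -> forall j : nat, exists F C L',
    definable2 M F /\ finite_family F /\ 0 < C /\ 0 <= L' /\
    (forall x, member F x -> Rabs x <= L') /\
    forall r n, 0 < r -> cover_number E r n ->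
      exists l, separated (C * r) l /\ (forall x, In x l -> member F x) /\
        length l = (n ^ (2 ^ j))%nat.
Proof.
  intros HdE HL0 HL HE HZ.
  induction j as [|j (F & C & L' & HF & Hfin & HC & HL' & HFb & Hcov)].
  - exists (gap_ends E), 1, (L + 1).
    split; [apply definable_definable1 in HdE; unfold gap_ends, adherent; definable_tac|].
    split; [now apply (gap_ends_finite_family E L)|].
    split; [lra|]. split; [lra|]. split.
    + intros x (e & _ & Hx & _). now apply (adherent_bounded E).
    + intros r n Hr Hn. rewrite Rmult_1_l, Nat.pow_0_r, Nat.pow_1_r.
      now apply gap_ends_cover.
  - destruct (quotients_gap M F HF Hfin HZ) as (t & eta & Heta & Hgap).
    exists (shear t F), (eta * C), (L' + Rabs t * L').
    pose proof (Rabs_pos t) as Ht.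
    split; [unfold shear; definable_tac|].
    split; [now apply shear_finite_family|].
    split; [apply Rmult_lt_0_compat; lra|].
    split; [nra|].
    split.
    + intros z (e & He & x & y & Hx & Hy & ->).
      assert (Hx' : Rabs x <= L') by (apply HFb; now exists e).
      assert (Hy' : Rabs y <= L') by (apply HFb; now exists e).
      unfold Rminus. apply Rle_trans with (1 := Rabs_triang _ _).
      rewrite Rabs_Ropp, Rabs_mult. nra.
    + intros r n Hr Hn. destruct (Hcov r n Hr Hn) as (l & [Hnd Hsep] & Hl & Hlen).
      assert (Hfar : forall u w, In u (list_prod l l) -> In w (list_prod l l) -> u <> w ->
        eta * C * r <= Rabs (fst u - t * snd u - (fst w - t * snd w))).
      { intros [x y] [x' y'] Hu Hw Hne. apply in_prod_iff in Hu, Hw. simpl.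
        destruct Hu as [Hx Hy]. destruct Hw as [Hx' Hy'].
        assert (HCr : 0 < C * r) by (apply Rmult_lt_0_compat; lra).
        replace (x - t * y - (x' - t * y')) with (x - x' - t * (y - y')) by ring.
        (* With equal second coordinates the first ones differ, and eta <= 1 suffices. *)
        destruct (Req_dec y y') as [<-|Hyy].
        - replace (x - x' - t * (y - y)) with (x - x') by ring.
          assert (x <> x') by congruence. specialize (Hsep x x' Hx Hx' H). nra.
        - specialize (Hsep y y' Hy Hy' Hyy).
          apply Rle_trans with (2 := Hgap x x' y y' (Hl x Hx) (Hl x' Hx') (Hl y Hy) (Hl y' Hy')).
          nra. }
      assert (HeCr : 0 < eta * C * r)
        by (apply Rmult_lt_0_compat; [apply Rmult_lt_0_compat|]; lra).
      exists (map (fun u => fst u - t * snd u) (list_prod l l)). repeat split.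
      * apply NoDup_map_NoDup_ForallPairs.
        -- intros u w Hu Hw Heq. apply NNPP. intro Hne. specialize (Hfar u w Hu Hw Hne).
           rewrite Heq, Rminus_diag, Rabs_R0 in Hfar. lra.
        -- now apply NoDup_list_prod.
      * intros z z' Hz Hz' Hne. apply in_map_iff in Hz, Hz'.
        destruct Hz as (u & <- & Hu). destruct Hz' as (w & <- & Hw).
        apply Hfar; auto. congruence.
      * intros z Hz. apply in_map_iff in Hz. destruct Hz as ([x y] & <- & Hu).
        apply in_prod_iff in Hu. destruct Hu as [Hx Hy].
        destruct (member_two F x y Hfin (Hl x Hx) (Hl y Hy)) as (e & He & H1 & H2).
        exists e. split; [assumption|]. exists x, y. auto.
      * rewrite length_map, length_prod, Hlen, <- Nat.pow_add_r. f_equal. simpl. lia.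
Qed.

Theorem mainTheorem1 (M : expansion) :
  definable M Zset \/
  (forall E : R -> Prop,
      definable M E -> bounded E -> nowhere_dense E -> M_null E).
Proof.
  destruct (classic (definable M Zset)) as [HZ|HZ]; [now left|right].
  intros E HdE Hb HE. split; [assumption|]. intros eps Heps.
  destruct Hb as (m1 & m2 & Hm).
  pose (L := Rabs m1 + Rabs m2).
  assert (HL0 : 0 <= L) by (unfold L; pose proof (Rabs_pos m1); pose proof (Rabs_pos m2); lra).
  assert (HL : forall x, E x -> Rabs x <= L).
  { intros x Hx. specialize (Hm x Hx). apply Rabs_le. unfold L.
    pose proof (Rabs_pos m1). pose proof (Rabs_pos m2).
    pose proof (Rle_abs m2). pose proof (Rle_abs (- m1)) as H'.
    rewrite Rabs_Ropp in H'. lra. }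
  (* With 2^j > 2 / eps, a covering number above r^(-eps) has its 2^j-th power above r^(-2), too
     many separated points for a bounded set. *)
  destruct (INR_unbounded (2 / eps)) as [j Hj].
  assert (Hj2 : 2 / eps < INR (2 ^ j)).
  { apply Rlt_trans with (1 := Hj). apply lt_INR. apply Nat.pow_gt_lin_r. lia. }
  destruct (separated_power M E L HdE HL0 HL HE HZ j)
    as (F & C & L' & _ & _ & HC & HL' & HFb & Hcov).
  (* Below this bound r (2 L' + C) < C, and r < 1 when [n] is nonzero and the quotient exceeds
     [eps]; so 2 L' r + C r^2 < C. *)
  exists (C / (2 * L' + C)). split; [apply Rdiv_lt_0_compat; lra|].
  intros r [Hr Hrd] n Hn. destruct (Nat.eq_dec n 0) as [H0|H0]; [now left|right].
  apply Rnot_lt_le. intro Hbig.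
  apply (Rmult_lt_compat_r (2 * L' + C)) in Hrd; [|lra].
  replace (C / (2 * L' + C) * (2 * L' + C)) with C in Hrd by (field; lra).
  assert (Hr1 : r < 1) by nra.
  assert (Hln : 0 < ln (1 / r)).
  { rewrite <- ln_1. apply ln_increasing; [lra|].
    unfold Rdiv. rewrite Rmult_1_l, <- Rinv_1. apply Rinv_lt_contravar; lra. }
  assert (Hn0 : 0 < INR n) by (apply lt_0_INR; lia).
  apply (Rmult_lt_compat_r (ln (1 / r))) in Hbig; [|assumption].
  replace (ln (INR n) / ln (1 / r) * ln (1 / r)) with (ln (INR n)) in Hbig by (field; lra).
  apply (Rmult_lt_compat_r eps) in Hj2; [|assumption].
  replace (2 / eps * eps) with 2 in Hj2 by (field; lra).
  assert (Hsq : (1 / r) ^ 2 < INR (n ^ (2 ^ j))).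
  { rewrite pow_INR. apply ln_lt_inv.
    - apply pow_lt. apply Rdiv_lt_0_compat; lra.
    - now apply pow_lt.
    - rewrite !ln_pow; [|assumption|apply Rdiv_lt_0_compat; lra].
      simpl (INR 2). assert (0 < INR (2 ^ j)) by nra. nra. }
  destruct (Hcov r n Hr Hn) as (l & Hsep & Hl & Hlen).
  assert (HCr : 0 < C * r) by (apply Rmult_lt_0_compat; lra).
  pose proof (separated_length (C * r) L' l HCr HL' Hsep (fun x Hx => HFb x (Hl x Hx)))
    as Hle.
  rewrite Hlen in Hle.
  (* Multiplying by C r^2 gives C < 2 L' r + C r^2, against the choice of the threshold. *)
  assert (Hc : (1 / r) ^ 2 < 2 * L' / (C * r) + 1) by lra.
  apply (Rmult_lt_compat_r (C * r * r)) in Hc; [|nra].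
  replace ((1 / r) ^ 2 * (C * r * r)) with C in Hc by (field; lra).
  replace ((2 * L' / (C * r) + 1) * (C * r * r)) with (2 * L' * r + C * r * r) in Hc
    by (field; lra).
  nra.
Qed.
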